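(* Let $(P,\rhd,\lhd,\mathfrak B)$ be a quadratic Zinbiel-dendriform algebra with $a\ast b:=a\rhd b+a\lhd b$, let $(Q,\circ)$ be a Leibniz algebra with a non-degenerate bilinear form $\varpi$, and let $(P\otimes Q,\cdot)$ be the pre-Lie algebra with product $$(a\otimes x)\cdot(b\otimes y)=(a\rhd b)\otimes (x\circ y)-(b\lhd a)\otimes (y\circ x).$$ Define a bilinear form $\omega$ on $P\otimes Q$ by $\omega(a\otimes x,b\otimes y)=\mathfrak B(a,b)\varpi(x,y)$ for $a,b\in P$, $x,y\in Q$. Then $(P\otimes Q,\cdot,\omega)$ is a quadratic pre-Lie algebra if and only if $\varpi$ is skew-symmetric and for all $a,b,c\in P$, $x,y,z\in Q$: $$\mathfrak B(b,a\ast c)\big(\varpi(x\circ y,z)+\varpi(y,x\circ z)\big)+\mathfrak B(b,c\ast a)\big(\varpi(x\circ y,z)+\varpi(y\circ x,z)-\varpi(y,z\circ x)\big)=0.$$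
   Context: All vector spaces are over a field $\mathbb K$. Standing convention of the paper: algebras are finite-dimensional. Zinbiel-dendriform algebra $(P,\rhd,\lhd)$: bilinear operations such that, with $x\ast y=x\rhd y+x\lhd y$: $x\rhd(y\rhd z)=(x\ast y+y\ast x)\rhd z$ and $x\rhd(z\lhd y)=z\lhd(x\ast y)=(x\rhd z)\lhd y+(z\lhd x)\lhd y$. It is quadratic if equipped with a non-degenerate symmetric bilinear form $\mathfrak B$ that is invariant: $\mathfrak B(x\rhd y,z)=\mathfrak B(y,x\ast z+z\ast x)$ and $\mathfrak B(x\lhd y,z)=-\mathfrak B(y,z\rhd x+x\lhd z)$. Leibniz algebra: $x\circ(y\circ z)=(x\circ y)\circ z+y\circ(x\circ z)$. Pre-Lie algebra $(L,\cdot)$: $(x\cdot y)\cdot z-x\cdot(y\cdot z)=(y\cdot x)\cdot z-y\cdot(x\cdot z)$. A quadratic pre-Lie algebra is a pre-Lie algebra with a non-degenerate skew-symmetric bilinear form $\omega$ such that $\omega(x\cdot y,z)=-\omega(y,[x,z])$ for all $x,y,z$, where $[x,z]=x\cdot z-z\cdot x$. *)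

(* Defs.v *)
From HB Require Import structures.
From mathcomp Require Import all_boot all_algebra.

Set Implicit Arguments.
Unset Strict Implicit.
Unset Printing Implicit Defensive.

Import GRing.Theory.
Local Open Scope ring_scope.

(* The library's [nondegenerate] and [{skew_symmetric _}] only apply to forms
   that are already known to be (skew-)hermitian; here these properties have to
   be predicates on an arbitrary bilinear form. *)
Section Forms.
Variables (K : fieldType) (V : vectType K) (f : {biscalar V}).

Definition form_symmetric : Prop := forall x y, f x y = f y x.

Definition form_skew_symmetric : Prop := forall x y, f x y = - f y x.

Definition form_nondegenerate : Prop :=
  (forall x, (forall y, f x y = 0) -> x = 0) /\
  (forall y, (forall x, f x y = 0) -> y = 0).

End Forms.

Section Algebras.
Variables (K : fieldType) (V : vectType K).

Definition zd_sum (rhd lhd : {bilinear V -> V -> V}) (x y : V) : V :=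
  rhd x y + lhd x y.

Definition zinbiel_dendriform (rhd lhd : {bilinear V -> V -> V}) : Prop :=
  let ast := zd_sum rhd lhd in
  [/\ forall x y z, rhd x (rhd y z) = rhd (ast x y + ast y x) z,
      forall x y z, rhd x (lhd z y) = lhd z (ast x y)
    & forall x y z, lhd z (ast x y) = lhd (rhd x z) y + lhd (lhd z x) y].

Definition quadratic_zinbiel_dendriform (rhd lhd : {bilinear V -> V -> V})
    (B : {biscalar V}) : Prop :=
  let ast := zd_sum rhd lhd in
  [/\ zinbiel_dendriform rhd lhd,
      form_symmetric B,
      form_nondegenerate B,
      forall x y z, B (rhd x y) z = B y (ast x z + ast z x)
    & forall x y z, B (lhd x y) z = - B y (rhd z x + lhd x z)].

Definition leibniz (circ : {bilinear V -> V -> V}) : Prop :=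
  forall x y z, circ x (circ y z) = circ (circ x y) z + circ y (circ x z).

Definition pre_lie (dot : {bilinear V -> V -> V}) : Prop :=
  forall x y z,
    dot (dot x y) z - dot x (dot y z) = dot (dot y x) z - dot y (dot x z).

Definition quadratic_pre_lie (dot : {bilinear V -> V -> V})
    (omega : {biscalar V}) : Prop :=
  [/\ pre_lie dot,
      form_nondegenerate omega,
      form_skew_symmetric omega
    & forall x y z, omega (dot x y) z = - omega y (dot x z - dot z x)].

End Algebras.

(* Coordinates are taken in the bases [vbasis {:P}] and [vbasis {:Q}];
   [tensor_universal] shows that [tensor P Q] has, with [tens], the universal
   property of the tensor product, so the choice of bases is immaterial. *)
Section Tensor.
Variables (K : fieldType) (P Q : vectType K).

Definition tensor : Type := 'M[K]_(\dim {:P}, \dim {:Q}).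

HB.instance Definition _ := Vector.copy tensor 'M[K]_(\dim {:P}, \dim {:Q}).

Definition tens (a : P) (x : Q) : tensor :=
  \matrix_(i, j) (coord (vbasis {:P}) i a * coord (vbasis {:Q}) j x).

Lemma tens_is_bilinear : bilinear_for *:%R *:%R tens.
Proof.
split=> [x|a] k u v; apply/matrixP=> i j; rewrite !mxE linearP /=.
  by rewrite mulrDl mulrA.
by rewrite mulrDr mulrCA.
Qed.

HB.instance Definition _ :=
  isBilinear.Build K P Q tensor *:%R *:%R tens
    (fun v => zmod_morphism_linear (tens_is_bilinear.1 v))
    (fun u => zmod_morphism_linear (tens_is_bilinear.2 u))
    (fun v => scalable_linear (tens_is_bilinear.1 v))
    (fun u => scalable_linear (tens_is_bilinear.2 u)).

(* The linear extension to [tensor P Q] of a bilinear map [f]. *)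
Definition tens_lift (V : lmodType K) (f : P -> Q -> V) (u : tensor) : V :=
  \sum_i \sum_j u i j *: f (vbasis {:P})`_i (vbasis {:Q})`_j.

Lemma tens_lift_is_linear (V : lmodType K) (f : P -> Q -> V) :
  linear (tens_lift f).
Proof.
move=> k u v; rewrite /tens_lift scaler_sumr -big_split /=.
apply: eq_bigr => i _; rewrite scaler_sumr -big_split /=.
by apply: eq_bigr => j _; rewrite !mxE scalerDl scalerA.
Qed.

HB.instance Definition _ (V : lmodType K) (f : P -> Q -> V) :=
  GRing.isLinear.Build K tensor V *:%R (tens_lift f) (tens_lift_is_linear f).

Lemma tens_liftE (V : lmodType K) (f : P -> Q -> V) :
  bilinear_for *:%R *:%R f -> forall a x, tens_lift f (tens a x) = f a x.
Proof.
move=> fP a x.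
pose F : {bilinear P -> Q -> V} :=
  HB.pack f (bilinear_isBilinear.Build K P Q V *:%R *:%R f fP).
rewrite -[RHS]/(F a x) [in RHS](coord_vbasis (memvf a)) linear_sumlz.
apply: eq_bigr => i _.
rewrite [in RHS](coord_vbasis (memvf x)) linear_sumr; apply: eq_bigr => j _.
by rewrite mxE linearZl_LR linearZr_LR scalerA.
Qed.

Lemma tens_vbasis (i : 'I_(\dim {:P})) (j : 'I_(\dim {:Q})) :
  tens (vbasis {:P})`_i (vbasis {:Q})`_j = delta_mx i j.
Proof.
apply/matrixP=> k l.
rewrite !mxE !coord_free ?(basis_free (vbasisP _)) // -natrM mulnb.
by rewrite [i == k]eq_sym [j == l]eq_sym.
Qed.

Lemma tens_decomp (u : tensor) :
  u = \sum_i \sum_j u i j *: tens (vbasis {:P})`_i (vbasis {:Q})`_j.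
Proof.
rewrite [LHS]matrix_sum_delta; apply: eq_bigr => i _; apply: eq_bigr => j _.
by rewrite tens_vbasis.
Qed.

Lemma tensor_universal (V : lmodType K) (f : {bilinear P -> Q -> V}) :
  exists2 g : {linear tensor -> V}, forall a x, g (tens a x) = f a x &
    forall h : {linear tensor -> V}, (forall a x, h (tens a x) = f a x) ->
      forall u, h u = g u.
Proof.
have fP : bilinear_for *:%R *:%R f.
  by split=> [x|a] k u v; rewrite ?linearPl ?linearPr.
exists (tens_lift f) => [a x|h hE u]; first exact: tens_liftE.
rewrite [u in LHS]tens_decomp linear_sum; apply: eq_bigr => i _.
by rewrite linear_sum; apply: eq_bigr => j _; rewrite linearZ hE.
Qed.

End Tensor.

Section TensorBilinear.
Variables (K : fieldType) (P Q : vectType K).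

Lemma tens_lift2_is_bilinear (V : lmodType K) (f : P -> Q -> P -> Q -> V) :
  bilinear_for *:%R *:%R
    (fun u v : tensor P Q =>
       tens_lift (fun a x => tens_lift (fun b y => f a x b y) v) u).
Proof.
split=> [v|u] k s t /=; first by rewrite linearP.
rewrite /tens_lift scaler_sumr -big_split /=.
apply: eq_bigr => i _; rewrite scaler_sumr -big_split /=.
apply: eq_bigr => j _; rewrite -/(tens_lift _ _).
by rewrite [X in _ *: X]linearP /= scalerDr !scalerA mulrC.
Qed.

Lemma tens_lift2E (V : lmodType K) (f : P -> Q -> P -> Q -> V) :
  (forall b y, bilinear_for *:%R *:%R (fun a x => f a x b y)) ->
  (forall a x, bilinear_for *:%R *:%R (f a x)) ->
  forall a x b y,
    tens_lift (fun a x => tens_lift (fun b y => f a x b y) (tens b y))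
      (tens a x) = f a x b y.
Proof.
move=> fl fr a x b y; rewrite tens_liftE ?tens_liftE //; split=> [x'|a'] k u v.
  by rewrite !tens_liftE // (fl b y).1.
by rewrite !tens_liftE // (fl b y).2.
Qed.

Section Product.
Variables (rhd lhd : {bilinear P -> P -> P}) (circ : {bilinear Q -> Q -> Q}).

Definition tensor_mul (u v : tensor P Q) : tensor P Q :=
  tens_lift (fun a x => tens_lift (fun b y =>
    tens (rhd a b) (circ x y) - tens (lhd b a) (circ y x)) v) u.

Lemma tensor_mul_is_bilinear : bilinear_for *:%R *:%R tensor_mul.
Proof. exact: tens_lift2_is_bilinear. Qed.

HB.instance Definition _ :=
  isBilinear.Build K (tensor P Q) (tensor P Q) (tensor P Q) *:%R *:%R tensor_mul
    (fun v => zmod_morphism_linear (tensor_mul_is_bilinear.1 v))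
    (fun u => zmod_morphism_linear (tensor_mul_is_bilinear.2 u))
    (fun v => scalable_linear (tensor_mul_is_bilinear.1 v))
    (fun u => scalable_linear (tensor_mul_is_bilinear.2 u)).

Lemma tensor_mulE a x b y :
  tensor_mul (tens a x) (tens b y) =
    tens (rhd a b) (circ x y) - tens (lhd b a) (circ y x).
Proof.
rewrite /tensor_mul tens_lift2E // => {a x b y} c z; split=> [x|a] k u v;
  by rewrite /= !(linearPl, linearPr) scalerBr opprD addrACA.
Qed.

End Product.

Section Form.
Variables (B : {biscalar P}) (varpi : {biscalar Q}).

Definition tensor_form (u v : tensor P Q) : K :=
  tens_lift (fun a x => tens_lift (fun b y => B a b * varpi x y : K^o) v) u.

Lemma tensor_form_is_bilinear : bilinear_for *%R *%R tensor_form.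
Proof. exact: (@tens_lift2_is_bilinear K^o). Qed.

HB.instance Definition _ :=
  isBilinear.Build K (tensor P Q) (tensor P Q) K *%R *%R tensor_form
    (fun v => zmod_morphism_linear (tensor_form_is_bilinear.1 v))
    (fun u => zmod_morphism_linear (tensor_form_is_bilinear.2 u))
    (fun v => scalable_linear (tensor_form_is_bilinear.1 v))
    (fun u => scalable_linear (tensor_form_is_bilinear.2 u)).

Lemma tensor_formE a x b y :
  tensor_form (tens a x) (tens b y) = B a b * varpi x y.
Proof.
rewrite /tensor_form tens_lift2E // => {a x b y} c z; split=> [x|a] k u v.
- by rewrite /= linearPl mulrDl -mulrA.
- by rewrite /= linearPl mulrDr mulrCA.
- by rewrite /= linearPr mulrDl -mulrA.
- by rewrite /= linearPr mulrDr mulrCA.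
Qed.

End Form.

End TensorBilinear.

(* Main.v *)
(** All identities are multilinear, so they are checked on pure tensors.
Symmetry and the two invariance rules of [B] give
[B (lhd b a) c = - B b (c * a)]; with it, the defect
[omega (u v) w + omega v (u w - w u)] of invariance on pure tensors is
literally the left-hand side of the stated identity.  The product is pre-Lie
because in a Leibniz algebra [(x y) z] is skew-symmetric in [x, y], which makes
all terms cancel after normalization.  Skew-symmetry passes from [omega] to
[varpi] since [B] takes a non-zero value when [P] is non-zero. *)
Require Import Defs.
From HB Require Import structures.
From mathcomp Require Import all_boot all_algebra ring.

Set Implicit Arguments.
Unset Strict Implicit.
Unset Printing Implicit Defensive.

Import GRing.Theory.
Local Open Scope ring_scope.

Section Tensor.
Variables (K : fieldType) (P Q : vectType K).
Implicit Types u v w : tensor P Q.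

(** Closure under scaling comes for free: a scalar is absorbed into the first factor of a pure
    tensor. *)
Lemma tensor_ind (X : tensor P Q -> Prop) :
  X 0 -> (forall u v, X u -> X v -> X (u + v)) ->
  (forall a x, X (tens a x)) -> forall u, X u.
Proof.
move=> X0 XD XT u; rewrite [u]tens_decomp.
apply: big_rec => // i v _; apply: (XD) => //.
apply: big_rec => // j w _; apply: XD => //.
by rewrite -linearZl_LR; exact: XT.
Qed.

Lemma tensor_form_skew_symmetric (B : {biscalar P}) (varpi : {biscalar Q}) :
  form_symmetric B -> form_skew_symmetric varpi ->
  form_skew_symmetric (tensor_form B varpi).
Proof.
move=> Bsym skew; elim/tensor_ind => [v|u1 u2 IH1 IH2 v|a x].
- by rewrite linear0l linear0r oppr0.
- by rewrite linearDl linearDr IH1 IH2 opprD.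
elim/tensor_ind => [|v1 v2 IH1 IH2|b y].
- by rewrite linear0l linear0r oppr0.
- by rewrite linearDl linearDr IH1 IH2 opprD.
by rewrite /= !tensor_formE Bsym skew mulrN.
Qed.

Lemma skew_symmetric_of_tensor_form (B : {biscalar P}) (varpi : {biscalar Q}) :
  (exists a : P, a != 0) -> form_symmetric B -> form_nondegenerate B ->
  form_skew_symmetric (tensor_form B varpi) -> form_skew_symmetric varpi.
Proof.
move=> [a a_neq0] Bsym [Bl _] skew x y; apply/eqP; rewrite -subr_eq0 opprK.
(* If [varpi x y + varpi y x] were non-zero, skew-symmetry on [tens a x] and [tens b y] would force
   [B a b = 0] for every [b]. *)
apply: contraNT a_neq0 => xy_neq0; apply/eqP/Bl => b.
have := skew (tens a x) (tens b y); rewrite /= !tensor_formE [B b a]Bsym.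
move/eqP; rewrite -subr_eq0 opprK -mulrDr mulf_eq0 (negPf xy_neq0) orbF.
by move/eqP.
Qed.

Lemma vbasis_sum_eq0 (V : vectType K) (k : 'I_(\dim {:V}) -> K) :
  \sum_i k i *: (vbasis {:V})`_i = 0 -> forall i, k i = 0.
Proof. exact/freeP/basis_free/vbasisP. Qed.

(** The factors are stripped one at a time. Each row of [u] is a vector of [Q] to be killed by
    pairing with every [y]; for fixed [y] these pairings are the coordinates of a vector of [P],
    whose pairing with [b] is the value of the form at [u] and [tens b y]. *)
Lemma tensor_form_nondegenerate (B : {biscalar P}) (varpi : {biscalar Q}) :
  form_nondegenerate B -> form_nondegenerate varpi ->
  form_nondegenerate (tensor_form B varpi).
Proof.
move=> [Bl Br] [wl wr]; split=> u u0; apply/matrixP=> i j; rewrite mxE.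
  move: j; apply/vbasis_sum_eq0/wl => y; rewrite linear_sumlz.
  move: i; apply/vbasis_sum_eq0/Bl => b; rewrite linear_sumlz.
  rewrite -[RHS](u0 (tens b y)) [u in RHS]tens_decomp linear_sumlz.
  apply: eq_bigr => i _; rewrite linear_sumlz linearZl_LR /= mulr_suml.
  apply: eq_bigr => j _; rewrite !linearZl_LR /= tensor_formE; ring.
move: j; apply/vbasis_sum_eq0/wr => y; rewrite linear_sumr.
move: i; apply/vbasis_sum_eq0/Br => b; rewrite linear_sumr.
rewrite -[RHS](u0 (tens b y)) [u in RHS]tens_decomp linear_sumr.
apply: eq_bigr => i _; rewrite linear_sumr linearZr_LR /= mulr_suml.
apply: eq_bigr => j _; rewrite !linearZr_LR /= tensor_formE; ring.
Qed.

Section Product.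
Variables (rhd lhd : {bilinear P -> P -> P}) (circ : {bilinear Q -> Q -> Q}).
Hypotheses (hP : zinbiel_dendriform rhd lhd) (hQ : leibniz circ).
Local Notation dot := (tensor_mul rhd lhd circ).

(** Adding the Leibniz identity to its copy with [x] and [y] exchanged cancels the right-nested
    products. *)
Lemma leibniz_left_skew x y z : circ (circ y x) z = - circ (circ x y) z.
Proof.
apply/eqP; rewrite -addr_eq0; have /eqP := hQ x y z.
by rewrite (hQ y x z) addrA addrC -subr_eq0 opprD addNKr oppr_eq0 addrC.
Qed.

Lemma tensor_mul_pre_lie_tens a b c x y z :
  dot (dot (tens a x) (tens b y)) (tens c z) -
    dot (tens a x) (dot (tens b y) (tens c z)) =
  dot (dot (tens b y) (tens a x)) (tens c z) -
    dot (tens b y) (dot (tens a x) (tens c z)).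
Proof.
have [hrr hrl hll] := hP.
rewrite /= !tensor_mulE !linearBl !linearBr /= !tensor_mulE.
apply/matrixP=> i j; rewrite !mxE.
(* Normal form in [Q]: only [(xy)z], [(xz)y], [(yz)x], [y(xz)], [z(xy)] and [z(yx)] remain. *)
rewrite (leibniz_left_skew x y z) (leibniz_left_skew y z x).
rewrite (leibniz_left_skew x z y) (hQ y z x) (hQ x z y) (hQ x y z).
rewrite !hrr !hrl.
(* The last axiom is used in coordinates, solved for [lhd (rhd a c) b] and [lhd (rhd b c) a];
   eliminating these two leaves a polynomial identity. *)
have := hll b a c; have := hll a b c.
rewrite /zd_sum !(linearDl, linearDr) /=.
move=> /(congr1 (coord (vbasis {:P}) i)) ha.
move=> /(congr1 (coord (vbasis {:P}) i)) hb.
move: ha hb; rewrite !(linearD, linearN) /=.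
move=> /eqP; rewrite -subr_eq => /eqP <-.
move=> /eqP; rewrite -subr_eq => /eqP <-.
ring.
Qed.

Lemma tensor_mul_pre_lie : pre_lie dot.
Proof.
elim/tensor_ind => [v w|u1 u2 IH1 IH2 v w|a x].
- by rewrite !(linear0l, linear0r).
- rewrite !(linearDl, linearDr) opprD addrACA IH1 IH2.
  by rewrite [in RHS]opprD [RHS]addrACA.
elim/tensor_ind => [w|v1 v2 IH1 IH2 w|b y].
- by rewrite !(linear0l, linear0r).
- rewrite !(linearDl, linearDr) opprD addrACA IH1 IH2.
  by rewrite [in RHS]opprD [RHS]addrACA.
elim/tensor_ind => [|w1 w2 IH1 IH2|c z].
- by rewrite !(linear0l, linear0r).
- rewrite !(linearDl, linearDr) opprD addrACA IH1 IH2.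
  by rewrite [in RHS]opprD [RHS]addrACA.
exact: tensor_mul_pre_lie_tens.
Qed.

End Product.

Lemma tensor_invariant_form
    (dot : {bilinear tensor P Q -> tensor P Q -> tensor P Q})
    (omega : {biscalar tensor P Q}) :
  (forall a b c x y z,
    omega (dot (tens a x) (tens b y)) (tens c z) =
    - omega (tens b y) (dot (tens a x) (tens c z) - dot (tens c z) (tens a x))) ->
  forall u v w, omega (dot u v) w = - omega v (dot u w - dot w u).
Proof.
move=> inv; elim/tensor_ind => [v w|u1 u2 IH1 IH2 v w|a x].
- by rewrite !(linear0l, linear0r) subrr linear0r oppr0.
- by rewrite !(linearDl, linearDr) IH1 IH2 !(linearDr, linearNr) /=; ring.
elim/tensor_ind => [w|v1 v2 IH1 IH2 w|b y].
- by rewrite !(linear0l, linear0r) oppr0.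
- by rewrite !(linearDl, linearDr) IH1 IH2 -opprD !linearDr.
elim/tensor_ind => [|w1 w2 IH1 IH2|c z].
- by rewrite !(linear0l, linear0r) subrr linear0r oppr0.
- by rewrite !(linearDl, linearDr) IH1 IH2 !(linearDr, linearNr) /=; ring.
exact: inv.
Qed.

End Tensor.

Section Invariance.
Variables (K : fieldType) (P : vectType K).
Variables (rhd lhd : {bilinear P -> P -> P}) (B : {biscalar P}).
Hypothesis hP : quadratic_zinbiel_dendriform rhd lhd B.

(** Symmetry and invariance bring both sides to [- B a (rhd c b + lhd b c)]. *)
Lemma form_lhd_adjoint a b c : B (lhd b a) c = - B b (zd_sum rhd lhd c a).
Proof.
have [_ Bsym _ Br Bl] := hP.
rewrite /zd_sum linearDr [B b (rhd c a)]Bsym [B b (lhd c a)]Bsym.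
rewrite Br !Bl /zd_sum !linearDr /=; ring.
Qed.

End Invariance.

(** [P_neq0] excludes the zero algebra, for which the tensor product is zero and quadratic whether
    or not [varpi] is skew-symmetric. *)
Theorem proposition3p18 (K : fieldType) (P Q : vectType K)
    (rhd lhd : {bilinear P -> P -> P}) (B : {biscalar P})
    (circ : {bilinear Q -> Q -> Q}) (varpi : {biscalar Q})
    (P_neq0 : exists a : P, a != 0)
    (hP : quadratic_zinbiel_dendriform rhd lhd B)
    (hQ : leibniz circ)
    (hvarpi : form_nondegenerate varpi) :
  quadratic_pre_lie (tensor_mul rhd lhd circ) (tensor_form B varpi) <->
  form_skew_symmetric varpi /\
  forall (a b c : P) (x y z : Q),
    B b (zd_sum rhd lhd a c) *
      (varpi (circ x y) z + varpi y (circ x z)) +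
    B b (zd_sum rhd lhd c a) *
      (varpi (circ x y) z + varpi (circ y x) z - varpi y (circ z x)) = 0.
Proof.
have [zdP Bsym Bnd Br _] := hP.
have invE a b c x y z :
    tensor_form B varpi (tensor_mul rhd lhd circ (tens a x) (tens b y))
      (tens c z) +
    tensor_form B varpi (tens b y)
      (tensor_mul rhd lhd circ (tens a x) (tens c z) -
       tensor_mul rhd lhd circ (tens c z) (tens a x)) =
    B b (zd_sum rhd lhd a c) *
      (varpi (circ x y) z + varpi y (circ x z)) +
    B b (zd_sum rhd lhd c a) *
      (varpi (circ x y) z + varpi (circ y x) z - varpi y (circ z x)).
  (* In the commutator, the [rhd] and [lhd] terms pair up into [zd_sum rhd lhd a c] beside
     [circ x z] and [zd_sum rhd lhd c a] beside [circ z x]. *)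
  rewrite !tensor_mulE linearBl !linearBr /= !tensor_formE.
  rewrite Br (form_lhd_adjoint hP) /zd_sum !linearDr /=; ring.
split=> [[_ _ skew inv]|[skew inv]].
  split=> [|a b c x y z]; first exact: skew_symmetric_of_tensor_form skew.
  by rewrite -invE inv addNr.
split.
- exact: tensor_mul_pre_lie.
- exact: tensor_form_nondegenerate.
- exact: tensor_form_skew_symmetric.
apply: tensor_invariant_form => a b c x y z.
by apply/eqP; rewrite -addr_eq0 invE inv.
Qed.
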